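(* Let $\mathfrak{M}$ be a variety of (connected) coarse spaces that contains $(X,\mathcal{E}_d)$ for some unbounded metric space $(X,d)$. Then $\mathfrak{M}=\mathfrak{M}_\omega$, that is, $\mathfrak{M}$ is the variety of all (connected) coarse spaces.
   Context: A coarse structure on a set $X$ is a family $\mathcal{E}$ of subsets of $X\times X$ such that: (i) each $\varepsilon\in\mathcal{E}$ contains the diagonal $\triangle_X=\{(x,x):x\in X\}$; (ii) if $\varepsilon,\delta\in\mathcal{E}$ then $\varepsilon\circ\delta=\{(x,y):\exists z\,((x,z)\in\varepsilon,\ (z,y)\in\delta)\}\in\mathcal{E}$ and $\varepsilon^{-1}=\{(y,x):(x,y)\in\varepsilon\}\in\mathcal{E}$; (iii) if $\varepsilon\in\mathcal{E}$ and $\triangle_X\subseteq\varepsilon'\subseteq\varepsilon$ then $\varepsilon'\in\mathcal{E}$. A subfamily $\mathcal{E}'\subseteq\mathcal{E}$ is a base for $\mathcal{E}$ if every $\varepsilon\in\mathcal{E}$ is contained in some $\varepsilon'\in\mathcal{E}'$. The pair $(X,\mathcal{E})$ is a coarse space; $B(x,\varepsilon)=\{y\in X:(x,y)\in\varepsilon\}$. It is connected if for all $x,y\in X$ there is $\varepsilon\in\mathcal{E}$ with $y\in B(x,\varepsilon)$. All coarse spaces are assumed connected and nonempty. A subset $Y\subseteq X$ is bounded if $Y\subseteq B(x,\varepsilon)$ for some $x\in X$, $\varepsilon\in\mathcal{E}$. A subspace of $(X,\mathcal{E})$ is a (nonempty) subset $Y\subseteq X$ with the coarse structure $\mathcal{E}|_Y=\{\varepsilon\cap(Y\times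 Y):\varepsilon\in\mathcal{E}\}$. A mapping $f:(X,\mathcal{E})\to(X',\mathcal{E}')$ is coarse if for every $\varepsilon\in\mathcal{E}$ there is $\varepsilon'\in\mathcal{E}'$ with $f(B(x,\varepsilon))\subseteq B(f(x),\varepsilon')$ for all $x\in X$. If $f$ is surjective and coarse, $(X',\mathcal{E}')$ is a coarse image of $(X,\mathcal{E})$. An asymorphism is a bijection $f$ with $f$ and $f^{-1}$ coarse. The product of a family $\{(X_\alpha,\mathcal{E}_\alpha):\alpha<\lambda\}$ is the Cartesian product of the sets $X_\alpha$ with the coarse structure whose base consists of the entourages $(\varepsilon_\alpha)_{\alpha<\lambda}$, one for each choice of $\varepsilon_\alpha\in\mathcal{E}_\alpha$, where $((x_\alpha),(y_\alpha))\in(\varepsilon_\alpha)_{\alpha<\lambda}$ iff $(x_\alpha,y_\alpha)\in\varepsilon_\alpha$ for every $\alpha<\lambda$. A variety is a class of coarse spaces, closed under asymorphisms, that is closed under formation of subspaces, coarse images and (arbitrary) products. $\mathfrak{M}_\omega$ is the class of all coarse spaces in which every finite subset is bounded. A metric $d$ on $X$ (with finite real values) defines the coarse structure $\mathcal{E}_d$ on $X$ with the base $\{\{(x,y):d(x,y)\le n\}: n\in\omega\}$; a metric space is regarded as a coarse space in this way. *)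

(* Defs.v *)
From mathcomp Require Import all_boot all_order all_algebra.
From mathcomp Require Import all_classical reals topology.
Set Implicit Arguments.
Unset Strict Implicit.
Unset Printing Implicit Defensive.
Import Order.TTheory GRing.Theory Num.Theory.
Local Open Scope classical_set_scope.
Local Open Scope ring_scope.

(* The composition and inverse are those of [relation_scope], where [d \; e] is
   {(x, y) | exists z, (x, z) in e and (z, y) in d}, usually written e o d; the
   ball B(x, e) is [xsection e x]. *)
Record coarse_structure (X : Type) (E : set (set (X * X))) : Prop := {
  coarse_diag : forall e, E e -> diagonal `<=` e ;
  coarse_comp : forall e d, E e -> E d -> E (d \; e)%relation ;
  coarse_inv : forall e, E e -> E (e^-1)%relation ;
  coarse_sub : forall e e', E e -> diagonal `<=` e' -> e' `<=` e -> E e' }.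

(* The only family satisfying the axioms of a coarse structure that can have B
   as a base. *)
Definition coarse_generated (X : Type) (B : set (set (X * X))) :
    set (set (X * X)) :=
  [set e | diagonal `<=` e /\ exists2 b, B b & e `<=` b].

(* Connectedness and nonemptiness are standing assumptions, hence part of the
   structure. *)
Record coarseSpace : Type := CoarseSpace {
  coarse_carrier :> Type ;
  coarse_ent : set (set (coarse_carrier * coarse_carrier)) ;
  coarse_entP : coarse_structure coarse_ent ;
  coarse_connected : forall x y : coarse_carrier,
    exists2 e, coarse_ent e & xsection e x y ;
  coarse_nonempty : [set: coarse_carrier] !=set0 }.
Arguments coarse_ent : clear implicits.

Definition coarse_bounded (X : coarseSpace) (Y : set X) : Prop :=
  exists x : X, exists2 e, coarse_ent X e & Y `<=` xsection e x.

Definition coarse_map (X X' : coarseSpace) (f : X -> X') : Prop :=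
  forall e, coarse_ent X e -> exists2 e', coarse_ent X' e' &
    forall x, f @` xsection e x `<=` xsection e' (f x).

Definition coarse_image (X X' : coarseSpace) : Prop :=
  exists2 f : X -> X', set_surj [set: X] [set: X'] f & coarse_map f.

Definition asymorphic (X X' : coarseSpace) : Prop :=
  exists (f : X -> X') (g : X' -> X),
    [/\ cancel f g, cancel g f, coarse_map f & coarse_map g].

Lemma coarse_generatedP (X : Type) (B : set (set (X * X))) :
    (forall b, B b -> diagonal `<=` b) ->
    (forall b c, B b -> B c -> exists2 a, B a & (c \; b)%relation `<=` a) ->
    (forall b, B b -> exists2 a, B a & (b^-1)%relation `<=` a) ->
  coarse_structure (coarse_generated B).
Proof.
move=> Bd Bc Bi; split.
- by move=> e [].
- move=> e d [de [b Bb eb]] [dd [c Bc' dc]]; split.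
    by move=> [x _] /diagonalP <-; exists x; [exact: de|exact: dd].
  have [a Ba bca] := Bc _ _ Bb Bc'; exists a => //.
  apply: subset_trans bca => -[x y] [z /= exz dzy].
  by exists z; [apply: eb|apply: dc].
- move=> e [de [b Bb eb]]; split.
    by move=> [x _] /diagonalP <-; apply: de.
  have [a Ba ba] := Bi _ Bb; exists a => //.
  by apply: subset_trans ba => -[x y] /= /eb.
- move=> e e' [de [b Bb eb]] de' e'e; split=> //.
  by exists b => //; apply: subset_trans eb.
Qed.

Lemma coarse_generated_base (X : Type) (B : set (set (X * X))) b :
  (forall b, B b -> diagonal `<=` b) -> B b -> coarse_generated B b.
Proof. by move=> Bd Bb; split; [apply: Bd|exists b]. Qed.

Section Subspace.
Variables (X : coarseSpace) (Y : set X) (Y0 : Y !=set0).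

Definition subspace_ent : set (set ({x | Y x} * {x | Y x})) :=
  [set [set pq | e (sval pq.1, sval pq.2)] | e in coarse_ent X].

Lemma subspace_entP : coarse_structure subspace_ent.
Proof.
have [Xd Xc Xi Xs] := coarse_entP X.
have eqd e : coarse_ent X e -> forall x, e (x, x).
  by move=> Ee x; apply: (Xd _ Ee).
split.
- by move=> _ [e Ee <-] [p _] /diagonalP <- /=; exact: (eqd _ Ee).
- move=> _ _ [e Ee <-] [d Ed <-].
  (* the composite is taken inside Y, so it is cut out by a subset of d \; e *)
  pose c := [set xy : X * X | xy.1 = xy.2 \/
    exists z, [/\ Y z, e (xy.1, z) & d (z, xy.2)]].
  exists c.
    apply: (Xs _ _ (Xc _ _ Ee Ed)); first by move=> xy ?; left.
    move=> [x y] [/= ->|[z [_ exz dzy]]]; last by exists z.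
    by exists y => /=; [exact: (eqd _ Ee)|exact: (eqd _ Ed)].
  apply/seteqP; split=> -[p q] /=.
    case=> [/= pq|[z [Yz ez dz]]]; last by exists (exist _ z Yz).
    by exists q => /=; rewrite ?pq; [exact: (eqd _ Ee)|exact: (eqd _ Ed)].
  by move=> [[z Yz] /= ez dz]; right; exists z.
- by move=> _ [e Ee <-]; exists (e^-1)%relation => //; apply: Xi.
- move=> _ e' [e Ee <-] de' e'e.
  exists [set xy : X * X | xy.1 = xy.2 \/
    exists p q, [/\ sval p = xy.1, sval q = xy.2 & e' (p, q)]].
    apply: (Xs _ _ Ee); first by move=> xy ?; left.
    move=> [x y] [/= ->|[p [q /= [<- <- /e'e]]] //]; exact: (eqd _ Ee).
  apply/seteqP; split=> -[p q] /=; last by move=> ?; right; exists p, q.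
  case=> [/= /eq_sig_hprop pq|[p' [q' [pp qq]]]].
    by apply: de'; apply/diagonalP; apply: pq => x; exact: Prop_irrelevance.
  have hp u v : sval u = sval v -> u = v :> {x | Y x}.
    by move/eq_sig_hprop; apply => x; exact: Prop_irrelevance.
  by rewrite (hp _ _ pp) (hp _ _ qq).
Qed.

Lemma subspace_connected (p q : {x | Y x}) :
  exists2 e, subspace_ent e & xsection e p q.
Proof.
have [e Ee] := coarse_connected (sval p) (sval q).
rewrite /xsection/= inE => epq.
by eexists; [exists e; [exact: Ee|reflexivity]|apply: mem_set].
Qed.

Lemma subspace_nonempty : [set: {x | Y x}] !=set0.
Proof. by have [x Yx] := Y0; exists (exist _ x Yx). Qed.

Definition coarse_subspace : coarseSpace :=
  CoarseSpace subspace_entP subspace_connected subspace_nonempty.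

End Subspace.

Section Product.
Variables (I : Type) (X : I -> coarseSpace).

Definition product_base : set (set ((forall i, X i) * (forall i, X i))) :=
  [set [set xy | forall i, e i (xy.1 i, xy.2 i)] |
    e in [set e : forall i, set (X i * X i) | forall i, coarse_ent (X i) (e i)]].

Lemma product_base_diag b : product_base b -> diagonal `<=` b.
Proof.
move=> [e Ee <-] [x _] /diagonalP <- i /=.
exact: (coarse_diag (coarse_entP (X i)) (Ee i)).
Qed.

Lemma product_entP : coarse_structure (coarse_generated product_base).
Proof.
apply: coarse_generatedP.
- exact: product_base_diag.
- move=> _ _ [e Ee <-] [d Ed <-].
  exists [set xy | forall i, (d i \; e i)%relation (xy.1 i, xy.2 i)].
    exists (fun i => (d i \; e i)%relation) => // i.
    exact: (coarse_comp (coarse_entP (X i)) (Ee i) (Ed i)).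
  by move=> [x y] [z /= exz dzy] i; exists (z i).
- move=> _ [e Ee <-].
  exists [set xy | forall i, ((e i)^-1)%relation (xy.1 i, xy.2 i)] => //.
  exists (fun i => ((e i)^-1)%relation) => // i.
  exact: (coarse_inv (coarse_entP (X i)) (Ee i)).
Qed.

Lemma product_connected (x y : forall i, X i) :
  exists2 e, coarse_generated product_base e & xsection e x y.
Proof.
have h i : {e | coarse_ent (X i) e & xsection e (x i) (y i)}.
  by apply: cid2; exact: coarse_connected.
exists [set xy | forall i, s2val (h i) (xy.1 i, xy.2 i)].
  apply: coarse_generated_base; first exact: product_base_diag.
  by exists (fun i => s2val (h i)) => // i; case: (h i).
apply: mem_set => i /=.
by case: (h i) => e _ /=; rewrite /xsection/= inE.
Qed.

Lemma product_nonempty : [set: forall i, X i] !=set0.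
Proof. by exists (fun i => sval (cid (coarse_nonempty (X i)))). Qed.

Definition coarse_product : coarseSpace :=
  CoarseSpace product_entP product_connected product_nonempty.

End Product.

Section MetricCoarse.
Variables (R : realType) (X : metricType R) (X0 : [set: X] !=set0).

Definition metric_base : set (set (X * X)) :=
  [set [set xy | mdist xy.1 xy.2 <= n%:R] | n in [set: nat]].

Lemma metric_base_diag b : metric_base b -> diagonal `<=` b.
Proof. by move=> [n _ <-] [x _] /diagonalP <- /=; rewrite mdistxx. Qed.

Lemma metric_entP : coarse_structure (coarse_generated metric_base).
Proof.
apply: coarse_generatedP.
- exact: metric_base_diag.
- move=> _ _ [n _ <-] [m _ <-].
  exists [set xy | mdist xy.1 xy.2 <= (n + m)%:R]; first by exists (n + m)%N.
  move=> [x y] [z /= xz zy]; rewrite natrD.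
  exact: le_trans (metric_triangle x z y) (lerD xz zy).
- move=> _ [n _ <-]; exists [set xy | mdist xy.1 xy.2 <= n%:R].
    by exists n.
  by move=> [x y] /=; rewrite metric_sym.
Qed.

Lemma metric_connected (x y : X) :
  exists2 e, coarse_generated metric_base e & xsection e x y.
Proof.
exists [set xy | mdist xy.1 xy.2 <= (Num.truncn (mdist x y)).+1%:R].
  apply: coarse_generated_base; first exact: metric_base_diag.
  by exists (Num.truncn (mdist x y)).+1.
apply: mem_set; apply: ltW; apply: truncnS_gt.
Qed.

Definition metric_coarse : coarseSpace :=
  CoarseSpace metric_entP metric_connected X0.

End MetricCoarse.

(* A class of coarse spaces is a predicate [coarseSpace -> Prop]; index types
   of products range over all types of the universe of the carriers, including
   the empty ones. *)
Record variety (M : coarseSpace -> Prop) : Prop := {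
  variety_asymorphic : forall X X', asymorphic X X' -> M X -> M X' ;
  variety_subspace : forall (X : coarseSpace) (Y : set X) (Y0 : Y !=set0),
    M X -> M (coarse_subspace Y0) ;
  variety_image : forall X X', coarse_image X X' -> M X -> M X' ;
  variety_product : forall (I : Type) (X : I -> coarseSpace),
    (forall i, M (X i)) -> M (coarse_product X) }.

Definition coarse_M_omega (X : coarseSpace) : Prop :=
  forall A : set X, finite_set A -> coarse_bounded A.

(* Main.v *)
Require Import Defs.
From mathcomp Require Import all_boot all_order all_algebra.
From mathcomp Require Import all_classical reals topology.
Set Implicit Arguments.
Unset Strict Implicit.
Unset Printing Implicit Defensive.
Import Order.TTheory GRing.Theory Num.Theory.
Local Open Scope classical_set_scope.

(** Only the domain of a coarse map has to be controlled, so it is enough to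
realize the finest connected coarse structure on a set C, in which two distinct
points are close only inside a finite set. An unbounded metric space contains a
sequence u in which d(u_i, u_j) <= n forces i = j or i, j <= n. Send c : C to
the point (u_(g c))_g of the power of X indexed by all g : C -> nat. If, for one
fixed product entourage, infinitely many points c had a close partner c' <> c,
then some g would be injective on a countable set of them, and 0 elsewhere; at
the coordinate g the entourage would then relate terms of u of unbounded
index. *)

(** Connectedness suffices: points join the ball one at a time, each by composing with an entourage
    that links it to the centre. *)
Lemma coarse_finite_bounded (C : coarseSpace) : coarse_M_omega C.
Proof.
have [Cd Cc _ _] := coarse_entP C.
have [x _] := coarse_nonempty C.
move=> A /(@finite_seqP {classic C})[s ->]; exists x.
elim: s => [|y s [e Ce se]].
  by have [e Ce _] := coarse_connected x x; exists e => // z.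
have [d Cde /xsectionP xy] := coarse_connected x y.
exists (e \; d)%relation; first exact: Cc.
move=> z /=; rewrite inE => /orP[/eqP ->|/se/xsectionP xz]; apply/xsectionP.
  by exists y => //=; apply: (Cd _ Ce); exact/diagonalP.
by exists x => //=; apply: (Cd _ Cde); exact/diagonalP.
Qed.

Lemma coarse_finite_square (C : coarseSpace) (A : set C) :
  finite_set A -> exists2 e, coarse_ent C e & A `*` A `<=` e.
Proof.
have [_ Cc Ci _] := coarse_entP C.
move=> /coarse_finite_bounded[x [e Ce Ae]].
exists (e \; e^-1)%relation; first by apply: Cc => //; exact: Ci.
move=> [y z] [/= /Ae + /Ae +]; rewrite !xsectionE /= => xy xz.
by exists x.
Qed.

Lemma infinite_separating_map (C : Type) (A : set C) : infinite_set A ->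
  exists g : C -> nat, forall n, exists c,
    [/\ A c, n < g c & forall c', c' <> c -> g c' <> g c].
Proof.
elim/Ppointed: C => C in A *; first by rewrite emptyE => -[]; exact: finite_set0.
move=> /infiniteP/pcard_leP/unsquash f.
(* The successor keeps values on the range of [f] apart from the default 0, so points outside the
   range, in [A] or not, never collide with it. *)
pose g c := if pselect (exists n, f n = c) is left h
  then (sval (cid h)).+1 else 0.
have gf n : g (f n) = n.+1.
  rewrite /g; case: pselect => [h|[]]; last by exists n.
  by case: cid => m /= /(@inj _ _ _ f) ->//; rewrite inE.
exists g => n; exists (f n); split; [exact: funS|by rewrite gf|].
move=> c' + gc; apply; move: gc; rewrite gf /g.
by case: pselect => // h; case: cid => m /= <- [->].
Qed.

Lemma unbounded_metric_sequence (R : realType) (X : metricType R)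
    (X0 : [set: X] !=set0) :
    ~ @coarse_bounded (metric_coarse X0) [set: X] ->
  exists u : nat -> X, forall i j n,
    (mdist (u i) (u j) <= n%:R)%R -> i <> j -> i <= n.
Proof.
move=> unb; have [x _] := X0.
have far (r : R) : {y | (r <= mdist x y)%R}.
  apply: cid; apply: contrapT => nfar; apply: unb; exists x.
  exists [set xy | mdist xy.1 xy.2 <= (Num.truncn r).+1%:R]%R.
    apply: coarse_generated_base; first exact: metric_base_diag.
    by exists (Num.truncn r).+1.
  move=> y _; rewrite xsectionE /=; apply: ltW; apply: lt_trans (truncnS_gt r).
  by rewrite ltNge; apply/negP => ry; apply: nfar; exists y.
(* Distances to [x] grow by at least [n.+1] at step [n]; for [i < j] the last increment alone puts
   [u j] at distance at least [j] from [u i]. *)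
pose u n := iteri n (fun i y => sval (far (mdist x y + i.+1%:R)%R)) x.
have uS n : (mdist x (u n) + n.+1%:R <= mdist x (u n.+1))%R.
  by rewrite /u /=; case: (far _).
have ulr i k : (mdist x (u i) + (i + k).+1%:R <= mdist x (u (i + k).+1))%R.
  elim: k => [|k IHk]; first by rewrite addn0.
  rewrite addnS; apply: le_trans (uS _); rewrite lerD2r.
  by apply: le_trans IHk; rewrite lerDl.
have ult i j : i < j -> (j%:R <= mdist (u i) (u j))%R.
  move=> /subnKC <-; rewrite addSn -(lerD2l (mdist x (u i))).
  by apply: le_trans (ulr _ _) _; exact: metric_triangle.
exists u => i j n uij /eqP; rewrite neq_ltn => /orP[ij|ji]; rewrite -(ler_nat R).
  by apply: le_trans uij; apply: le_trans (ult _ _ ij); rewrite ler_nat ltnW.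
by apply: le_trans uij; rewrite metric_sym; exact: ult.
Qed.

Lemma variety_unbounded_metric_full (M : coarseSpace -> Prop) (hM : variety M)
    (R : realType) (X : metricType R) (X0 : [set: X] !=set0) (C : coarseSpace) :
    ~ @coarse_bounded (metric_coarse X0) [set: X] -> M (metric_coarse X0) -> M C.
Proof.
move=> /unbounded_metric_sequence[u u_sep] MX.
have [_ _ _ Csub] := coarse_entP C.
pose P := coarse_product (fun _ : C -> nat => metric_coarse X0).
pose y (c : C) : P := fun g => u (g c).
have Y0 : range y !=set0.
  by have [c _] := coarse_nonempty C; exists (y c); exists c.
have y_inj : injective y.
  move=> c c' yy; apply: contrapT => ncc'.
  (* The indicator of [c] is a coordinate separating [c] from [c'], because [u 0] and [u 1] differ:
     distance 0 would force [1 <= 0]. *)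
  have := u_sep 1 0 0; rewrite (_ : u 1 = u 0) ?mdistxx.
    by move/(_ (lexx _)) => ne01; have : 1 <= 0 by exact: ne01.
  have := congr1 (fun p : P => p (fun x => `[<x = c>] : nat)) yy.
  by rewrite /y asboolT // asboolF // => cc'; apply: ncc'.
pose f (p : coarse_subspace Y0) : C := s2val (cid2 (svalP p)).
have yf p : y (f p) = sval p by rewrite /f; case: cid2.
apply: (variety_image hM (X := coarse_subspace Y0)); last first.
  by apply: variety_subspace => //; apply: variety_product.
exists f.
  move=> c _; have Yc : range y (y c) by exists c.
  by exists (exist _ (y c) Yc) => //; apply: y_inj; rewrite yf.
move=> _ [e [_ [_ [d dE <-] ed]] <-].
have dn g : {n : nat | d g `<=` [set xy | mdist xy.1 xy.2 <= n%:R]%R}.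
  by apply: cid; have [_ [_ [n _ <-] dn]] := dE g; exists n.
pose close c c' := forall g, (mdist (y c g) (y c' g) <= (sval (dn g))%:R)%R.
have close_sym c c' : close c c' -> close c' c.
  by move=> cc' g; rewrite metric_sym.
pose A := [set c | exists2 c', c' <> c & close c c'].
have finA : finite_set A.
  apply: contrapT => /infinite_separating_map[g g_sep].
  (* The radius [dn g] depends on [g], but it is fixed once [g] is, and [g] exceeds it at some [c]
     in [A]. *)
  have [c [[c' c'c cc'] ltg gsep]] := g_sep (sval (dn g)).
  have := u_sep _ _ _ (cc' g) (fun h => gsep _ c'c (esym h)).
  by rewrite leqNgt ltg.
have [e' Ce' Ae'] := coarse_finite_square finA.
(* Finiteness of [A] makes this an entourage of any connected [C]. *)
exists (diagonal `|` A `*` A).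
  have [Cd _ _ _] := coarse_entP C.
  apply: (Csub _ _ Ce'); first exact: subsetUl.
  by rewrite subUset; split => //; exact: Cd.
move=> p _ [q + <-]; rewrite !xsectionE /= => /ed pq.
have cpq : close (f p) (f q).
  move=> g; rewrite !yf; have := pq g.
  by case: (dn g) => n /= h; apply: h.
have [->|npq] := pselect (f p = f q); first by left; apply/diagonalP.
right; split; first by exists (f q) => // /esym.
by exists (f p) => //; exact: close_sym.
Qed.

Theorem mainTheorem2 (M : coarseSpace -> Prop) (hM : variety M)
    (R : realType) (X : metricType R) (X0 : [set: X] !=set0)
    (X_unbounded : ~ @coarse_bounded (metric_coarse X0) [set: X])
    (MX : M (metric_coarse X0)) :
  (forall C : coarseSpace, M C <-> coarse_M_omega C) /\
  (forall C : coarseSpace, M C).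
Proof.
have MC C : M C by exact: variety_unbounded_metric_full X_unbounded MX.
by split=> // C; split=> // _; exact: coarse_finite_bounded.
Qed.
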